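(* Let $\mathcal P$ be a set of $n\geq 1$ colinear points of $\mathbb R^2$. Then $\gamma^{\mathrm{ID}}_{D}(\mathcal P)=\left\lceil \frac{n+1}{2}\right\rceil$.
   Context: A disk of radius $r>0$ and center $c\in\mathbb R^2$ is the set of points of $\mathbb R^2$ at Euclidean distance at most $r$ from $c$. A point is covered by a disk if it belongs to it; two points are separated by a disk if exactly one of them is covered by it. A set $\mathcal D$ of disks identifies a finite set $\mathcal P\subseteq\mathbb R^2$ if every point of $\mathcal P$ is covered by some disk of $\mathcal D$ and every pair of distinct points of $\mathcal P$ is separated by some disk of $\mathcal D$. $\gamma^{\mathrm{ID}}_{D}(\mathcal P)$ denotes the minimum number of disks (of arbitrary radii) in a set identifying $\mathcal P$. *)

(* Defs.v *)
From mathcomp Require Import all_boot all_order all_algebra.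
From mathcomp Require Import finmap.
From mathcomp Require Import boolp classical_sets reals.

Set Implicit Arguments.
Unset Strict Implicit.
Unset Printing Implicit Defensive.

Import Order.TTheory GRing.Theory Num.Theory.
Local Open Scope classical_set_scope.
Local Open Scope ring_scope.

(* The norm `|p - q| that MathComp puts on row vectors is the max-norm, hence
   this explicit Euclidean distance. *)
Definition edist (R : realType) (p q : 'rV[R]_2) : R :=
  Num.sqrt (\sum_(i < 2) (p 0 i - q 0 i) ^+ 2).

Definition disk_of (R : realType) (c : 'rV[R]_2) (r : R) : set 'rV[R]_2 :=
  [set x | edist x c <= r].

Definition disk (R : realType) (D : set 'rV[R]_2) : Prop :=
  exists (c : 'rV[R]_2) (r : R), 0 < r /\ D = disk_of c r.

Definition covered (R : realType) (p : 'rV[R]_2) (D : set 'rV[R]_2) : Prop :=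
  D p.

Definition separated (R : realType) (p q : 'rV[R]_2) (D : set 'rV[R]_2) : Prop :=
  (covered p D /\ ~ covered q D) \/ (~ covered p D /\ covered q D).

(* Restricting to finite sets of disks does not affect the minimum below, since
   every finite P has a finite identifying set (identified_by_ex). *)
Definition identifies (R : realType) (DD : {fset set 'rV[R]_2})
    (P : {fset 'rV[R]_2}) : Prop :=
  [/\ forall D, D \in DD -> disk D,
      forall p, p \in P -> exists2 D, D \in DD & covered p D
    & forall p q, p \in P -> q \in P -> p != q ->
        exists2 D, D \in DD & separated p q D].

Definition identified_by (R : realType) (P : {fset 'rV[R]_2}) : pred nat :=
  fun k => `[< exists DD : {fset set 'rV[R]_2},
                 identifies DD P /\ #|` DD| = k >].

Definition colinear (R : realType) (P : {fset 'rV[R]_2}) : Prop :=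
  exists a v : 'rV[R]_2,
    v != 0 /\ forall p, p \in P -> exists t : R, p = a + t *: v.

Lemma edistxx (R : realType) (p : 'rV[R]_2) : edist p p = 0.
Proof.
by rewrite /edist big1 ?sqrtr0 // => i _; rewrite subrr expr0n.
Qed.

Lemma edist_gt0 (R : realType) (p q : 'rV[R]_2) : p != q -> 0 < edist p q.
Proof.
move=> pq; rewrite /edist sqrtr_gt0 lt_def sumr_ge0 ?andbT => [|i _]; last first.
  exact: sqr_ge0.
apply: contra pq; rewrite psumr_eq0 => [/allP h|i _]; last exact: sqr_ge0.
apply/eqP/rowP => i; apply/eqP; rewrite -subr_eq0 -sqrf_eq0.
exact: h (mem_index_enum i).
Qed.

Lemma isolating_radius (R : realType) (p : 'rV[R]_2) (s : seq 'rV[R]_2) :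
  exists r : R, 0 < r /\ forall q, q \in s -> q != p -> r < edist q p.
Proof.
elim: s => [|x s [r [r0 hr]]]; first by exists 1; split.
have [->|xp] := eqVneq x p.
  exists r; split=> // q; rewrite inE => /orP[/eqP ->|]; last exact: hr.
  by rewrite eqxx.
have d0 := edist_gt0 xp.
exists (Num.min r (edist x p / 2)); split.
  by rewrite lt_min r0 divr_gt0.
move=> q; rewrite inE => /orP[/eqP -> _|qs qp].
  by rewrite gt_min [X in _ || X]ltr_pdivrMr // ltr_pMr // ltr1n orbT.
by rewrite gt_min hr.
Qed.

Lemma identified_by_ex (R : realType) (P : {fset 'rV[R]_2}) :
  exists k, identified_by P k.
Proof.
have [f hf] := choice (fun p => isolating_radius p (enum_fset P)).
pose DD := [fset disk_of p (f p) | p in P]%fset.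
have memDD p : p \in P -> disk_of p (f p) \in DD.
  by move=> pP; apply/imfsetP; exists p.
have selfD p : disk_of p (f p) p.
  by rewrite /disk_of /= edistxx ltW //; case: (hf p).
exists #|` DD|; apply/asboolP; exists DD; split=> //; split.
- by move=> D /imfsetP[p _ ->]; exists p, (f p); split=> //; case: (hf p).
- by move=> p pP; exists (disk_of p (f p)); [exact: memDD|exact: selfD].
- move=> p q pP qP pq; exists (disk_of p (f p)); first exact: memDD.
  left; split; first exact: selfD.
  rewrite /covered /disk_of /= => /le_lt_trans h.
  have [_ /(_ q qP)] := hf p; rewrite eq_sym => /(_ pq) /h.
  by rewrite ltxx.
Qed.

Definition gammaID (R : realType) (P : {fset 'rV[R]_2}) : nat :=
  ex_minn (identified_by_ex P).

(* Main.v *)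
Require Import Defs.
From mathcomp Require Import all_boot all_order all_algebra.
From mathcomp Require Import finmap.
From mathcomp Require Import boolp classical_sets reals.
From mathcomp Require Import zify ring lra.

Import Order.TTheory GRing.Theory Num.Theory.
Local Open Scope ring_scope.

(** A disk meets the line in an interval, so along the [n] sorted points, with a
    virtual uncovered point added at each end, it separates at most two of the
    [n + 1] pairs of neighbours, once on entering and once on leaving it. Every
    such pair must be separated, whence [n + 1 <= 2 * k] for [k] disks.
    Conversely, for [k = n./2 + 1], the [k] windows of [k] consecutive points
    starting at the points [0, ..., k - 1] identify up to [2 * k - 1] points. *)

(** Each switch [g] is sent to its [D] together with the value of [m D] at [g], which tells leaving
    from entering. An interval is entered and left at most once, so this map into [T * bool] is
    injective. *)
Lemma interval_switches (T : finType) (m : T -> nat -> bool) (n : nat) :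
  (forall D i j k, (i <= j <= k)%N -> m D i -> m D k -> m D j) ->
  (forall g, (g <= n)%N -> exists D, m D g != m D g.+1) ->
  (n.+1 <= #|T| * 2)%N.
Proof.
move=> conv sw.
have [f fP] := choice (fun g : 'I_n.+1 => sw g (ltn_ord g)).
pose F g := (f g, m (f g) g).
suff Finj : injective F.
  by have := leq_card _ Finj; rewrite card_ord card_prod card_bool.
suff noLt (g h : 'I_n.+1) : (g < h)%N -> F g = F h -> False.
  move=> g h Fgh; apply: val_inj; case: (ltngtP g h) => // lt_gh.
    by case: (noLt _ _ lt_gh Fgh).
  by case: (noLt _ _ lt_gh (esym Fgh)).
(* If both values are true, [g.+1] is a gap between [g] and [h]; if both are false, [h] is a gap
   between [g.+1] and [h.+1]. *)
move=> lt_gh [fgh mgh]; have := fP g; have := fP h; rewrite -mgh -fgh.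
have := conv (f g) g g.+1 h; have := conv (f g) g.+1 h h.+1.
rewrite lt_gh !leqnSn {}mgh -fgh /=.
by case: (m _ h); case: (m _ h.+1); case: (m _ g.+1) => // c1 c2;
  [have := c2 isT isT isT | have := c1 isT isT isT].
Qed.

Lemma windows_cover (k i : nat) :
  (i < k.*2.-1)%N -> exists2 j, (j < k)%N & (j <= i < j + k)%N.
(* The last admissible window starting no later than [i]. *)
Proof. by move=> ik; exists (minn i k.-1); lia. Qed.

Lemma windows_separate (k i j : nat) : (i < j < k.*2.-1)%N ->
  exists2 w, (w < k)%N & (w <= i < w + k)%N != (w <= j < w + k)%N.
Proof.
move=> ijk; have [ik|ki] := ltnP i k.-1.
  (* This window starts after [i] and contains [j]. *)
  by exists (minn j k.-1); lia.
(* This window ends exactly at [i], hence misses [j]. *)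
by exists (i - k.-1)%N; lia.
Qed.

Lemma disk_ofE (R : realType) (c x : 'rV[R]_2) (r : R) : 0 <= r ->
  disk_of c r x <-> (x 0 0 - c 0 0) ^+ 2 + (x 0 1 - c 0 1) ^+ 2 <= r ^+ 2.
Proof.
move=> r0; rewrite /disk_of /= /edist big_ord_recl big_ord1.
rewrite -[X in _ <= X]ger0_norm // -sqrtr_sqr ler_sqrt ?sqr_ge0 //.
by have -> : lift ord0 ord0 = 1 :> 'I_2 by exact: val_inj.
Qed.

Lemma disk_convex_line (R : realType) (D : set 'rV[R]_2) (a v : 'rV[R]_2)
    (x y z : R) : disk D -> x <= y <= z ->
  D (a + x *: v) -> D (a + z *: v) -> D (a + y *: v).
Proof.
move=> [c [r [r0 ->]]] /andP[xy yz].
rewrite !(disk_ofE _ _ _ _ (ltW r0)) !mxE => Dx Dz.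
(* With [x < y] the factor [z - x] below is positive and can be cancelled. *)
move: xy; rewrite le_eqVlt => /predU1P[<- //|xy].

pose f t := (a 0 0 + t * v 0 0 - c 0 0) ^+ 2 + (a 0 1 + t * v 0 1 - c 0 1) ^+ 2.
(* The defect of convexity of the quadratic [f] along [x <= y <= z]. *)
have fE : (z - y) * f x + (y - x) * f z - (z - x) * f y =
    (z - y) * (y - x) * (z - x) * (v 0 0 ^+ 2 + v 0 1 ^+ 2).
  by rewrite /f; ring.
have xz : 0 < z - x by lra.
rewrite -(ler_pM2l xz) -[leLHS]/((z - x) * f y).
have : 0 <= (z - y) * (y - x) * (z - x) * (v 0 0 ^+ 2 + v 0 1 ^+ 2).
  apply: mulr_ge0; last by rewrite addr_ge0 ?sqr_ge0.
  by rewrite !mulr_ge0 //; lra.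
rewrite -fE.
have : (z - y) * f x <= (z - y) * r ^+ 2 by apply: ler_wpM2l => //; lra.
have : (y - x) * f z <= (y - x) * r ^+ 2 by apply: ler_wpM2l => //; lra.
lra.
Qed.

(** The disk having the segment as a diameter works; [x < y] makes its radius positive. *)
Lemma disk_of_interval (R : realType) (a v : 'rV[R]_2) (x y : R) :
  v != 0 -> x < y ->
  exists D, disk D /\ forall t, D (a + t *: v) <-> x <= t <= y.
Proof.
move=> v0 xy; pose N := v 0 0 ^+ 2 + v 0 1 ^+ 2.
have N0 : 0 < N.
  rewrite lt_def addr_ge0 ?sqr_ge0 // andbT.
  apply: contra v0; rewrite paddr_eq0 ?sqr_ge0 // !sqrf_eq0.
  move=> /andP[/eqP e0 /eqP e1].
  apply/eqP/rowP => i; rewrite mxE; case: (unliftP 0 i) => [j|] -> //.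
  by rewrite -e1; congr (v _ _); rewrite (ord1 j); exact: val_inj.
pose r := (y - x) / 2 * Num.sqrt N.
have r0 : 0 < r by rewrite mulr_gt0 ?sqrtr_gt0 //; lra.
pose c := a + ((x + y) / 2) *: v.
exists (disk_of c r); split; first by exists c, r.
move=> t; rewrite (disk_ofE _ _ _ _ (ltW r0)) !mxE exprMn sqr_sqrtr ?(ltW N0) //.
(* Squared radius minus squared distance to the center is a quadratic in [t] with roots [x] and
   [y]. *)
rewrite -subr_ge0 (_ : _ - _ = N * ((t - x) * (y - t))); last by rewrite /N; field.
rewrite pmulr_rge0 //; split=> [h|/andP[h1 h2]]; last first.
  by rewrite mulr_ge0 // subr_ge0.
by apply/andP; split; rewrite leNgt; apply/negP => lt; nra.
Qed.

Lemma colinear_enum (R : realType) (P : {fset 'rV[R]_2}) : colinear P ->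
  exists (a v : 'rV[R]_2) (s : seq R), [/\ v != 0, sorted <%R s,
    size s = #|` P|%fset &
    forall p, p \in P <-> exists2 t, t \in s & p = a + t *: v].
Proof.
move=> [a [v [v0 Pv]]].
have /choice[f fP] p : exists t, p \in P -> p = a + t *: v.
  have [pP|_] := boolP (p \in P); last by exists 0.
  by have [t ->] := Pv p pP; exists t.
exists a, v, (sort <=%R [seq f p | p <- P]); split=> //.
(* Points of [P] with equal parameters coincide, so the sorted list is strictly increasing. *)
- rewrite sort_lt_sorted map_inj_in_uniq ?fset_uniq // => p q pP qP fpq.
  by rewrite (fP p pP) (fP q qP) fpq.
- by rewrite size_sort size_map.
- move=> p; split=> [pP|[t]].
    by exists (f p); [rewrite mem_sort map_f | exact: fP].
  by rewrite mem_sort => /mapP[q qP ->] ->; rewrite -fP.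
Qed.

Lemma identified_lower_bound (R : realType) (P : {fset 'rV[R]_2}) (k : nat) :
  (0 < #|` P|)%N -> colinear P -> identified_by P k -> (#|` P| < k * 2)%N.
Proof.
move=> P0 /(colinear_enum _ _)[a [v [s [v0 s_lt szs Ps]]]].
move=> /asboolP[DD [[DDdisk DDcov DDsep] <-]].
pose pt i : 'rV[R]_2 := a + nth 0 s i *: v.
have ptP i : (i < size s)%N -> pt i \in P.
  by move=> lt_i; apply/Ps; exists (nth 0 s i); rewrite ?mem_nth.
(* Positions are shifted by one: [i] stands for the point [pt i.-1], while [0] and [(size s).+1] are
   the virtual uncovered points. *)
pose m (D : DD) i := [&& 0 < i, i <= size s & `[< (val D) (pt i.-1) >]]%N.
rewrite -szs cardfE; apply: (interval_switches _ m).
  move=> D i j h /andP[ij jh] /and3P[i0 _ /asboolP Di] /and3P[_ hs /asboolP Dh].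
  apply/and3P; split; [lia | lia | apply/asboolP].
  apply: disk_convex_line _ _ _ _ _ _ _ _ _ Di Dh; first exact: DDdisk (valP D).
  by rewrite !(lt_sorted_leq_nth 0 s_lt) ?inE /=; lia.
have wit D i : (i < size s)%N -> m D i.+1 = `[< (val D) (pt i) >].
  by move=> lt_i; rewrite /m lt_i.
(* The two outer switches come from covering the first and the last point, the inner ones from
   separating neighbours. *)
move=> g gs; have [g0|g0] := posnP g.
  have lt0 : (0 < size s)%N by rewrite szs.
  have [D DDD Dp] := DDcov _ (ptP _ lt0); exists [` DDD]%fset.
  by rewrite g0 wit // asboolT.
have [lt_g|ge_g] := ltnP g (size s); last first.
  have lt_g : (g.-1 < size s)%N by lia.
  have [D DDD Dp] := DDcov _ (ptP _ lt_g); exists [` DDD]%fset.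
  rewrite -[X in m _ X](prednK g0) wit // asboolT //.
  by rewrite /m [X in [&& _, X & _]]ltnNge ge_g.
have lt_g1 : (g.-1 < size s)%N by lia.
have neq : pt g.-1 != pt g.
  rewrite (inj_eq (addrI _)) -subr_eq0 -scalerBl scaler_eq0 negb_or v0 andbT.
  rewrite subr_eq0 nth_uniq ?lt_sorted_uniq //; lia.
have [D DDD Dsep] := DDsep _ _ (ptP _ lt_g1) (ptP _ lt_g) neq.
exists [` DDD]%fset; rewrite -[X in m _ X](prednK g0) !wit //.
by case: Dsep => -[D1 D2]; [rewrite asboolT // asboolF | rewrite asboolF // asboolT].
Qed.

Lemma identified_upper_bound (R : realType) (P : {fset 'rV[R]_2}) :
  (0 < #|` P|)%N -> colinear P ->
  exists2 k, (k <= #|` P|./2.+1)%N & identified_by P k.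
Proof.
move=> P0 /(colinear_enum _ _)[a [v [s [v0 s_lt szs Ps]]]].
set n := #|` P|%fset in szs P0 *; set k := n./2.+1.
have nk : (n <= k.*2.-1)%N by rewrite /k; lia.
(* One value past the end, so that the last windows need no special case. *)
pose d : R := 1 + \sum_(t <- s) `|t|.
have s_d t : t \in s -> t < d.
  move=> ts; rewrite /d (big_rem t) //= addrCA.
  have : 0 <= \sum_(x <- rem t s) `|x| by apply: sumr_ge0.
  by have := ler_norm t; lra.
pose u i : R := nth d s i.
have u_lt i j : (i < n)%N -> (i < j)%N -> u i < u j.
  move=> lt_i ij; have [lt_j|ge_j] := ltnP j n.
    by apply: (sorted_ltn_nth lt_trans); rewrite ?inE ?szs.
  by rewrite [u j]nth_default ?szs // s_d // mem_nth ?szs.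
have u_le i j : (i < n)%N -> (i <= j)%N -> u i <= u j.
  by move=> lt_i; rewrite leq_eqVlt => /predU1P[-> //|/u_lt-/(_ lt_i)/ltW].
have /choice[W WP] (j : 'I_k) : exists D : set 'rV[R]_2, disk D /\
    forall i, (i < n)%N -> D (a + u i *: v) <-> (j <= i < j + k)%N.
  have lt_jn : (j < n)%N by have := ltn_ord j; rewrite /k; lia.
  have le1 : u j <= u (j + k.-1)%N by apply: u_le; lia.
  have lt2 : u j < u (j + k)%N by apply: u_lt; lia.
  (* Ending halfway to the next value, rather than at the last point of the window, keeps the
     interval nondegenerate when [k = 1]. *)
  have [|D [Ddisk DP]] := disk_of_interval R a v (u j)
      ((u (j + k.-1)%N + u (j + k)%N) / 2) v0; first by lra.
  exists D; split=> // i lt_i; rewrite DP; split=> /andP[h1 h2]; apply/andP; split.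
  - by rewrite leqNgt; apply/negP => /u_lt-/(_ lt_i); rewrite ltNge h1.
  - rewrite ltnNge; apply: contraL h2 => le_i; rewrite -ltNge.
    have := u_le (j + k)%N i ltac:(lia) le_i.
    by have := u_lt (j + k.-1)%N (j + k)%N ltac:(lia) ltac:(lia); lra.
  - exact: u_le.
  - have := u_le i (j + k.-1)%N lt_i ltac:(lia).
    by have := u_lt i (j + k)%N lt_i ltac:(lia); lra.
have Pu p : p \in P -> exists2 i, (i < n)%N & p = a + u i *: v.
  move=> /Ps[t ts ->]; exists (index t s); first by rewrite -szs index_mem.
  by rewrite /u nth_index.
have memW j : W j \in [fset W j | j in 'I_k]%fset by apply/imfsetP; exists j.
(* Equal disks would merge in the image set, so its size is only bounded by [k], which suffices for
   the minimum. *)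
exists #|` [fset W j | j in 'I_k]|%fset.
  by rewrite (leq_trans (leq_imfset_card _ _ _)) // -cardE card_ord.
apply/asboolP; exists [fset W j | j in 'I_k]%fset; split=> //; split.
- by move=> D /imfsetP[j _ ->]; case: (WP j).
- move=> p /Pu[i lt_i ->]; have [j lt_j ij] := windows_cover k i (leq_trans lt_i nk).
  by exists (W (Ordinal lt_j)) => //; apply/(proj2 (WP _)).
- move=> p q /Pu[i lt_i ->] /Pu[j lt_j ->] pq.
  have [w lt_w sep] : exists2 w, (w < k)%N &
      (w <= i < w + k)%N != (w <= j < w + k)%N.
    case: (ltngtP i j) => ij; last by rewrite ij eqxx in pq.
      by apply: windows_separate; lia.
    have [|w ? ?] := windows_separate k j i; first by lia.
    by exists w; rewrite // eq_sym.
  exists (W (Ordinal lt_w)) => //; rewrite /separated /covered.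
  have [_ Wi] := WP (Ordinal lt_w).
  move: (Wi _ lt_i) (Wi _ lt_j) sep => /=.
  by do 2!case: (_ <= _ < _)%N => //; [left | right]; intuition.
Qed.

Theorem theorem3 (R : realType) (n : nat) (P : {fset 'rV[R]_2})
    (n_ge1 : (1 <= n)%N) (cardP : #|` P|%fset = n) (colP : colinear P) :
  (gammaID P)%:Z = Num.ceil ((n%:R + 1) / 2 : R).
Proof.
have P0 : (0 < #|` P|)%N by rewrite cardP.
have -> : gammaID P = n./2.+1.
  rewrite /gammaID; case: ex_minnP => k.
  move=> /(identified_lower_bound _ _ _ P0 colP) lo min.
  have [h hle /min] := identified_upper_bound _ _ P0 colP.
  by move: lo hle; rewrite cardP; lia.
(* It remains to place [(n + 1) / 2] above [n./2] and at most at [n./2 + 1], which follows from [n]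
   being [2 * n./2] or one more. *)
apply/esym/ceil_def.
have : (n <= (n./2).*2.+1)%N by lia.
have : ((n./2).*2 <= n)%N by lia.
rewrite -!(ler_nat R) -addn1 -muln2 !natrD natrM => h1 h2.
by rewrite intrB -!pmulrn -(natr1 n./2); apply/andP; split; lra.
Qed.
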